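(* Let $m\ge 1$ be an integer, let $(b_1,\dots,b_m)$ be a family of positive real numbers and let $(m_1,\dots,m_m)$ be a family of integers with $m_i\ge 2$ for all $i$, such that (i) there exist $j,\ell\in\{1,\dots,m\}$ with $\frac{\log m_j}{\log m_\ell}\notin\mathbb{Q}$; (ii) $\sum_{j=1}^m b_j>1$. Let $s_0$ be the positive root of the equation $\sum_{j=1}^m b_j m_j^{-s}=1$. Then there exists a sequence $(\ell_j)_{j\ge 0}$ of positive real numbers (depending only on $m$, $(b_i)$ and $(m_i)$) such that for every sequence $(a_n)_{n\ge 0}$ of real numbers with $$\sum_{n=1}^{+\infty}\frac{|a_n|}{n^{s_0}}<+\infty,$$ the sequence $(X_n)_{n\ge 0}$ defined by $X_0=a_0$ and $$X_n=a_n+\sum_{j=1}^m b_j X_{\lfloor n/m_j\rfloor}\qquad (n\ge 1)$$ satisfies $$\lim_{n\to+\infty}\frac{X_n}{n^{s_0}}=\sum_{j=0}^{+\infty}\ell_j a_j.$$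
   Context: $\lfloor x\rfloor$ denotes the unique integer $n$ with $x-n\in[0,1)$. *)

(* Defs.v *)
From mathcomp Require Import all_boot all_order all_algebra.
From mathcomp Require Import all_classical all_reals all_analysis.

Set Implicit Arguments.
Unset Strict Implicit.
Unset Printing Implicit Defensive.

Import Order.TTheory GRing.Theory Num.Theory.
Local Open Scope ring_scope.

(* Euclidean division on nat is the floor of the real quotient. *)
Lemma floor_divn (R : realType) (n d : nat) :
  (0 < d)%N -> Num.floor (n%:R / d%:R : R) = (n %/ d)%N%:Z.
Proof.
move=> d0; have d0R : 0 < d%:R :> R by rewrite ltr0n.
apply/eqP; rewrite floor_eq ler_pdivlMr// ltr_pdivrMr//.
rewrite -[(_ + 1 : int)]/((n %/ d + 1)%N%:Z) !pmulrn -!natrM ler_nat ltr_nat.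
by rewrite leq_divM addn1 ltn_ceil.
Qed.

(* Main.v *)
Require Import Defs.
From mathcomp Require Import all_boot all_order all_algebra.
From mathcomp Require Import all_classical all_reals all_analysis.
From mathcomp Require Import zify ring lra.
Import Order.TTheory GRing.Theory Num.Theory.
Import numFieldNormedType.Exports.
Local Open Scope classical_set_scope.
Local Open Scope ring_scope.

(** The recurrence is linear, so [X n] is a superposition [\sum_k a k * Z k n],
where [Z k] solves the recurrence with the unit impulse at [k] as forcing term.
All the [Z k] come from one sequence, the solution [y] with [y 0 = 1] and no
forcing.  Indeed [n |-> y (n %/ k)] satisfies the homogeneous recurrence for
[n >= k], while for [0 < n < k] it is constantly [1] and misses the recurrence
by [1 - B], with [B = \sum_j b j].  Hence [(y (n %/ k) - y (n %/ k.+1)) / (B - 1)]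
is the response to an impulse at [k >= 1], and [Z 0 = y]
([impulse_response_rec], [recurrence_superposition]).

The heart of the matter is that [y n / n `^ s0] converges to some [c > 0].  In
logarithmic scale put [H t = y (floor (e^t)) e^(- s0 t)], [lam j = ln (mm j)] and
[p j = b j * mm j `^ (- s0)], which are probabilities by the choice of [s0].  Then
[H t = \sum_j p j * H (t - lam j)] for [t >= 0]: this is a renewal equation.  Its
solutions obey a maximum and a minimum principle ([renewal_le], [renewal_ge]):
a bound on a window as long as the largest step persists forever.  Let [L] be the
limsup of [H].  At a point [x] far out where [H x] is close to [L], the average
of values that hardly exceed [L] is close to [L], so each of them is, and so is
[H] at every [x - w], where [w] runs over bounded combinations of two steps with
irrational ratio ([renewal_back]).  Such combinations form a fine net
([semigroup_net]), and [H] cannot drop fast, because [e^(s0 t) H t] is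
nondecreasing; thus [H] is close to [L] on a whole window, and, by the minimum
principle, ever after.  So the liminf is [L] as well ([renewal_cvg]).

It follows that [Z k n / n `^ s0] tends to [ell k], where [ell 0 = c] and
[ell k = c (k^-s0 - k.+1^-s0) / (B - 1)].  Moreover it is
[O(k `^ (- s0))] for [k >= 1], uniformly in [n], so the summability of [|a k| / k `^ s0]
permits the passage to the limit under the sum ([series_dominated_cvg]). *)

(** * Nets from two incommensurable steps *)

(** The subgroup of the reals generated by [x] and [y] is dense: a halving form
of Euclid's algorithm on [x] and [y] never terminates. *)
Lemma small_integer_combination {R : realType} (x y e : R) :
  0 < x -> 0 < y -> irrational (x / y) -> 0 < e ->
  exists p q : int, 0 < p%:~R * x + q%:~R * y < e.
Proof.
move=> x0 y0 irr e0.
(* If [0 < d] is an integer combination, then [x] and [y] cannot both be multiples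
   of [d], since their ratio is irrational; the distance from one of them to the
   nearest multiple of [d] is a positive combination which is at most [d / 2]. *)
suff halving n : exists p q : int, 0 < p%:~R * x + q%:~R * y <= x / 2 ^+ n.
  pose n := (Num.truncn (x / e)).+1.
  have [p [q /andP[d0 dn]]] := halving n.
  exists p, q; rewrite d0 /=; apply: le_lt_trans dn _.
  rewrite ltr_pdivrMr ?exprn_gt0// mulrC -ltr_pdivrMr//.
  apply: lt_trans (truncnS_gt (x / e)) _.
  by rewrite -natrX ltr_nat -/n ltn_expl.
elim: n => [|n [p [q /andP[d0 dn]]]].
  by exists 1, 0; rewrite mul1r mul0r addr0 expr0 divr1 x0 lexx.
set d := _ + _ in d0 dn.
have reduce r s : let z := r%:~R * x + s%:~R * y in
    z != (Num.floor (z / d))%:~R * d ->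
    exists p q : int, 0 < p%:~R * x + q%:~R * y <= x / 2 ^+ n.+1.
  move=> z zd; set k := Num.floor _ in zd.
  have kz : k%:~R * d <= z by rewrite -ler_pdivlMr// floor_le.
  have zk : z < (k%:~R + 1) * d.
    by rewrite -ltr_pdivrMr// -[1]/(1%:~R) -intrD floorD1_gt.
  have half w : w <= d / 2 -> w <= x / 2 ^+ n.+1.
    move=> /le_trans; apply.
    by rewrite exprSr invfM mulrA ler_pM2r.
  have [small|big] := leP (z - k%:~R * d) (d / 2).
    exists (r - k * p), (s - k * q).
    have -> : (r - k * p)%:~R * x + (s - k * q)%:~R * y = z - k%:~R * d.
      by rewrite /z /d !intrB !intrM; ring.
    by rewrite half// subr_gt0 lt_neqAle eq_sym zd kz.
  exists ((k + 1) * p - r), ((k + 1) * q - s).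
  have -> : ((k + 1) * p - r)%:~R * x + ((k + 1) * q - s)%:~R * y
      = (k%:~R + 1) * d - z.
    by rewrite /z /d !intrB !intrM !intrD; ring.
  rewrite half; first by rewrite subr_gt0 zk.
  by lra.
have [xd|xd] := eqVneq x ((Num.floor (x / d))%:~R * d); last first.
  by apply: (reduce 1 0); rewrite mul1r mul0r addr0.
have [yd|yd] := eqVneq y ((Num.floor (y / d))%:~R * d); last first.
  by apply: (reduce 0 1); rewrite mul1r mul0r add0r.
exfalso; apply: irr.
exists ((Num.floor (x / d))%:~R / (Num.floor (y / d))%:~R) => //.
rewrite fmorph_div /= !ratr_int [in RHS]xd [in RHS]yd.
by rewrite -mulf_div divff ?mulr1 ?gt_eqF.
Qed.

(** Far out, even combinations with nonnegative coefficients are [e]-dense on an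
interval of any prescribed length [W].  The bound [N] on the coefficients makes
the net finite, so that the weights of all of its points have a common positive
lower bound. *)
Lemma semigroup_net {R : realType} (x y e W : R) :
  0 < x -> 0 < y -> irrational (x / y) -> 0 < e ->
  exists (A : R) (N : nat), 0 <= A /\ forall t, A <= t <= A + W ->
    exists a c : nat, [/\ (a <= N)%N, (c <= N)%N &
      t <= a%:R * x + c%:R * y <= t + e].
Proof.
move=> x0 y0 irr e0.
have [p [q /andP[d0 de]]] := small_integer_combination _ _ _ x0 y0 irr e0.
set d := _ + _ in d0 de.
(* [i] steps of size [d] with [i <= I] cover the length [W]; starting from [N] copies
   of both [x] and [y] keeps the coefficients [N + i p] and [N + i q] nonnegative. *)
pose I := (Num.truncn (W / d)).+1; pose N := (I * (`|p| + `|q|))%N.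
have shift (r : int) i : (i <= I)%N -> (`|r| <= `|p| + `|q|)%N ->
    exists2 a : nat, (a <= N + N)%N & a%:R = N%:R + i%:R * r%:~R :> R.
  move=> iI rpq; have irN : (absz (i%:Z * r)%R <= N)%N.
    by rewrite abszM absz_nat leq_mul.
  have pos : 0 <= N%:Z + i%:Z * r by lia.
  exists (absz (N%:Z + i%:Z * r)%R); first by lia.
  by rewrite -[LHS]/((absz _)%:Z%:~R) gez0_abs// intrD intrM.
exists (N%:R * (x + y)), (N + N)%N; split.
  by rewrite mulr_ge0// addr_ge0// ltW.
move=> t /andP[At tA]; pose i := (Num.truncn ((t - N%:R * (x + y)) / d)).+1.
have iI : (i <= I)%N.
  by rewrite ltnS le_truncn// ler_pM2r ?invr_gt0// lerBlDl.
have [a aN aE] := shift p i iI (leq_addr _ _).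
have [c cN cE] := shift q i iI (leq_addl _ _).
exists a, c; split => //; rewrite aE cE.
have -> : (N%:R + i%:R * p%:~R) * x + (N%:R + i%:R * q%:~R) * y
    = N%:R * (x + y) + i%:R * d by rewrite /d; ring.
have /truncn_itv/andP[lo hi] : 0 <= (t - N%:R * (x + y)) / d.
  by rewrite divr_ge0 ?subr_ge0// ltW.
move: lo hi; rewrite ler_pdivlMr// ltr_pdivrMr// -/i => lo hi.
rewrite -lerBlDl (ltW hi)/= /i -natr1 mulrDl mul1r.
by apply: le_trans (_ : N%:R * (x + y) + (t - N%:R * (x + y) + d) <= _); lra.
Qed.

(** * The renewal equation *)

(** Maximum principle: a value of [H] is an average of earlier values that are at
most [W] back. *)
Lemma renewal_le {R : realType} (m : nat) (p lam : 'I_m -> R) (d W : R)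
    (H : R -> R) (T M : R) :
  (forall j, 0 <= p j) -> \sum_(j < m) p j = 1 ->
  0 < d -> (forall j, d <= lam j <= W) ->
  (forall t, T <= t -> H t = \sum_(j < m) p j * H (t - lam j)) ->
  (forall t, T - W <= t < T -> H t <= M) ->
  forall t, T - W <= t -> H t <= M.
Proof.
move=> p0 p1 d0 dlam Heq HM.
(* Every step is at least [d] long, so that one use of the equation extends the
   bound by [d] to the right. *)
have steps n t : T - W <= t < T + n%:R * d -> H t <= M.
  elim: n t => [|n IHn] t; first by rewrite mul0r addr0; exact: HM.
  rewrite -natr1 mulrDl mul1r => /andP[t1 t2].
  have [tT|Tt] := ltP t T; first by apply: HM; rewrite t1.
  rewrite Heq// -[leRHS]mul1r -p1 mulr_suml ler_sum// => j _.
  rewrite ler_wpM2l// IHn//; have /andP[jd jW] := dlam j.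
  by apply/andP; split; lra.
move=> t Tt; apply: (steps (Num.truncn ((t - T) / d)).+1).
rewrite Tt /= -ltrBlDl -ltr_pdivrMr//; exact: truncnS_gt.
Qed.

Lemma renewal_ge {R : realType} (m : nat) (p lam : 'I_m -> R) (d W : R)
    (H : R -> R) (T M : R) :
  (forall j, 0 <= p j) -> \sum_(j < m) p j = 1 ->
  0 < d -> (forall j, d <= lam j <= W) ->
  (forall t, T <= t -> H t = \sum_(j < m) p j * H (t - lam j)) ->
  (forall t, T - W <= t < T -> M <= H t) ->
  forall t, T - W <= t -> M <= H t.
Proof.
move=> p0 p1 d0 dlam Heq HM t Tt; rewrite -lerN2.
apply: (@renewal_le _ _ p lam d W (fun u => - H u) T) => //.
- move=> u Tu; rewrite Heq// -sumrN.
  by apply: eq_bigr => j _; rewrite mulrN.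
- by move=> u /HM; rewrite lerN2.
Qed.

(** A nonnegative solution which is small at [t] is small at the points
[t - n * lam j] too, because it is an average and every weight is positive.  It is
meant for the defect [L + del - H] of a solution [H] near its limsup [L]. *)
Lemma renewal_back {R : realType} (m : nat) (p lam : 'I_m -> R) (W T : R)
    (D : R -> R) (j : 'I_m) :
  (forall i, 0 < p i) -> (forall i, 0 <= lam i <= W) ->
  (forall t, T <= t -> D t = \sum_(i < m) p i * D (t - lam i)) ->
  (forall t, T - W <= t -> 0 <= D t) ->
  forall (n : nat) t, T <= t - n%:R * lam j ->
    D (t - n%:R * lam j) <= D t / p j ^+ n.
Proof.
move=> p0 lamW Deq D0; elim=> [|n IHn] t; first by rewrite mul0r subr0 divr1.
have /andP[lj0 ljW] := lamW j.
rewrite -natr1 mulrDl mul1r opprD addrA => Tt.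
have Tn : T <= t - n%:R * lam j by lra.
rewrite exprSr invfM mulrA ler_pdivlMr//.
apply: le_trans (IHn _ Tn); rewrite [leRHS]Deq// (bigD1 j)//= mulrC lerDl.
apply: sumr_ge0 => i _; rewrite mulr_ge0 ?(ltW (p0 i))// D0//.
by have /andP[li0 liW] := lamW i; lra.
Qed.

(** A renewal theorem by elementary means.  The equation transports near-maximality
of [H] only to a net of points; the monotonicity of [expR (s * t) * H t], a
substitute for continuity, spreads it to the gaps of the net. *)
Lemma renewal_cvg {R : realType} (m : nat) (p lam : 'I_m -> R)
    (d W s K C : R) (H : R -> R) (j l : 'I_m) :
  (forall i, 0 < p i) -> \sum_(i < m) p i = 1 ->
  0 < d -> (forall i, d <= lam i <= W) -> irrational (lam j / lam l) ->
  (forall t, 0 <= t -> H t = \sum_(i < m) p i * H (t - lam i)) ->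
  0 <= K -> (forall t, 0 <= t -> K <= H t <= C) ->
  0 < s -> {homo (fun t => expR (s * t) * H t) : x y / x <= y} ->
  exists2 c, K <= c & H t @[t --> +oo] --> c.
Proof.
move=> p0 p1 d0 dlam irr Heq K0 Hbd s0 Hmono.
have lam0 i : 0 < lam i by have /andP[+ _] := dlam i; exact: lt_le_trans.
have W0 : 0 < W by have /andP[_] := dlam j; exact: lt_le_trans.
pose V := [set v | exists2 T, 0 <= T & forall t, T <= t -> H t <= v].
have VC : V C by exists 0 => // t /Hbd/andP[].
have VK : lbound V K.
  by move=> v [T T0 /(_ _ (lexx T))]; apply: le_trans; have /andP[] := Hbd T T0.
pose L := inf V; have KL : K <= L by apply: lb_le_inf => //; exists C.
have L0 : 0 <= L by exact: le_trans KL.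
have above e : 0 < e -> exists2 T, 0 <= T & forall t, T <= t -> H t <= L + e.
  move=> e0; have [|v [T T0 HT] vL] := @inf_adherent _ V _ e0.
    by split; [exists C | exists K].
  by exists T => // t /HT Hv; apply: le_trans Hv (ltW vL).
have often e T : 0 < e -> 0 <= T -> exists2 t, T <= t & L - e < H t.
  move=> e0 T0; apply: contrapT => no.
  suff : L <= L - e by lra.
  apply: ge_inf; first by exists K.
  exists T => // t Tt; rewrite leNgt; apply/negP => Ht.
  by apply: no; exists t.
(* The liminf of [H] is at least its limsup [L]. *)
have below e : 0 < e -> exists2 T, 0 <= T & forall t, T <= t -> L - e <= H t.
  move=> e0.
  (* On a distance [eta], the loss of at most [s * eta * L] that the monotonicity of
     [expR (s * t) * H t] allows is below [e / 2]. *)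
  pose eta := e / (2 * s * (L + 1)).
  have eta0 : 0 < eta by rewrite divr_gt0// !mulr_gt0//; lra.
  have [A [N [A0 net]]] := @semigroup_net _ _ _ _ W (lam0 j) (lam0 l) irr eta0.
  (* [q] bounds from below the weight of every net point; with [del = e * q / 4], a
     defect of [2 * del] at [x] becomes a defect of at most [e / 2] there. *)
  pose q := p j ^+ N * p l ^+ N.
  have q0 : 0 < q by rewrite mulr_gt0// exprn_gt0.
  have ple1 i : p i <= 1.
    by rewrite -p1 (bigD1 i)//= lerDl sumr_ge0// => k _; exact: ltW.
  pose del := e * q / 4.
  have del0 : 0 < del by rewrite divr_gt0// mulr_gt0.
  have [T T0 HT] := above del del0.
  have [x Tx Hx] := often del (T + W + A + W + eta) del0 ltac:(lra).
  pose D t := L + del - H t.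
  have Deq t : T + W <= t -> D t = \sum_(i < m) p i * D (t - lam i).
    move=> Tt; rewrite /D Heq; last by lra.
    rewrite -[in LHS](mul1r (L + del)) -p1 mulr_suml -sumrB.
    by apply: eq_bigr => i _; rewrite mulrBr.
  have D0 t : T + W - W <= t -> 0 <= D t.
    by rewrite addrK subr_ge0; exact: HT.
  have lamW i : 0 <= lam i <= W.
    by rewrite ltW//=; have /andP[] := dlam i.
  have good a c : (a <= N)%N -> (c <= N)%N ->
      T + W <= x - (a%:R * lam j + c%:R * lam l) ->
      L - e / 2 <= H (x - (a%:R * lam j + c%:R * lam l)).
    move=> aN cN; rewrite opprD addrA => Tac.
    have Ta : T + W <= x - a%:R * lam j.
      by apply: le_trans Tac _; rewrite gerDl oppr_le0 mulr_ge0// ltW.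
    have := @renewal_back _ _ p lam W _ D j p0 lamW Deq D0 a x Ta.
    rewrite ler_pdivlMr ?exprn_gt0// => Da.
    have := @renewal_back _ _ p lam W _ D l p0 lamW Deq D0 c _ Tac.
    rewrite ler_pdivlMr ?exprn_gt0// => Dc.
    set z := x - _ - _ in Tac Dc *.
    have Dz0 : 0 <= D z by apply: D0; lra.
    have : D z * q <= 2 * del.
      have ql : q <= p j ^+ a * p l ^+ c.
        by rewrite ler_pM// ?exprn_ge0 ?(ltW (p0 _))// ler_wiXn2l// ?(ltW (p0 _)).
      apply: le_trans (_ : D z * (p j ^+ a * p l ^+ c) <= _).
        by rewrite ler_wpM2l.
      rewrite mulrCA; apply: le_trans (_ : D x <= _); last by rewrite /D; lra.
      by apply: le_trans Da; rewrite mulrC ler_wpM2r// exprn_ge0// ltW.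
    rewrite -ler_pdivlMr// {1}/del.
    have -> : 2 * (e * q / 4) / q = e / 2 by field; rewrite gt_eqF.
    by rewrite /D => ?; lra.
  have window t : x - A - W <= t < x - A -> L - e <= H t.
    move=> /andP[t1 t2]; have [|a [c [aN cN /andP[w1 w2]]]] := net (x - t).
      by apply/andP; split; lra.
    set w := _ * _ + _ * _ in w1 w2.
    have Tw : T + W <= x - w by lra.
    have Hw := good a c aN cN Tw; rewrite -/w in Hw.
    have Hw0 : 0 <= H (x - w).
      by have /andP[+ _] := Hbd (x - w) ltac:(lra); exact: le_trans.
    have wt0 : x - w <= t by lra.
    have := Hmono _ _ wt0.
    have -> : s * t = s * (x - w) + s * (t - (x - w)) by ring.
    rewrite expRD -mulrA ler_pM2l ?expR_gt0// => Hle.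
    have wt : t - (x - w) <= eta by lra.
    have Ex : 1 - s * (t - (x - w)) <= expR (- (s * (t - (x - w)))).
      exact: expR_ge1Dx.
    have Hge : expR (- (s * (t - (x - w)))) * H (x - w) <= H t.
      by rewrite expRN mulrC ler_pdivrMr ?expR_gt0// mulrC.
    have seta : s * eta * (L + 1) = e / 2 by rewrite /eta; field; lra.
    have s_eta0 : 0 < s * eta by rewrite mulr_gt0.
    have [Le|Le] := ltP (L - e / 2) 0.
      by apply: le_trans (_ : 0 <= _); [lra | have /andP[] := Hbd t ltac:(lra); lra].
    apply: le_trans Hge.
    apply: le_trans (_ : (1 - s * eta) * (L - e / 2) <= _); first by nra.
    apply: le_trans (_ : expR (- (s * (t - (x - w)))) * (L - e / 2) <= _).
      rewrite ler_wpM2r//; apply: le_trans Ex.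
      by rewrite lerD2l lerN2 ler_pM2l.
    by rewrite ler_wpM2l// expR_ge0.
  exists (x - A); first by lra.
  move=> t xt.
  apply: (@renewal_ge _ _ p lam d W H (x - A)) => //.
  - by move=> i; exact: ltW.
  - by move=> u xu; apply: Heq; lra.
  - by lra.
exists L => //; apply/cvgrPdist_le => e e0.
have [T1 _ HT1] := above e e0; have [T2 _ HT2] := below e e0.
near=> t; rewrite ler_distlC; apply/andP; split.
  by apply: HT2; near: t; apply: nbhs_pinfty_ge; exact: num_real.
by apply: HT1; near: t; apply: nbhs_pinfty_ge; exact: num_real.
Unshelve. all: by end_near.
Qed.

(** * Growth of the homogeneous solution *)

Lemma exists_homogeneous_solution {R : realType} (m : nat) (b : 'I_m -> R)
    (mm : 'I_m -> nat) :
  (forall i, 2 <= mm i)%N ->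
  exists y : nat -> R, y 0%N = 1 /\
    forall n, (1 <= n)%N -> y n = \sum_(j < m) b j * y (n %/ mm j)%N.
Proof.
move=> mm2.
(* The first argument is fuel: [n] units suffice at [n], as [n %/ mm j < n]. *)
pose z := fix z (f n : nat) {struct f} : R := if f is f'.+1 then
  if n is 0%N then 1 else \sum_(j < m) b j * z f' (n %/ mm j)%N else 1.
have zE f g n : (n <= f)%N -> (n <= g)%N -> z f n = z g n.
  elim: f g n => [|f IHf] [|g] [|n]//= nf ng; apply: eq_bigr => j _.
  by congr (_ * _); have := ltn_Pdiv (mm2 j) (ltn0Sn n); rewrite ltnS => h;
     apply: IHf; apply: leq_trans h _.
exists (fun n => z n n); split => // -[//|n] _ /=.
apply: eq_bigr => j _; congr (_ * _); apply: zE => //.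
by have := ltn_Pdiv (mm2 j) (ltn0Sn n); rewrite ltnS.
Qed.

Lemma homogeneous_mono {R : realType} (m : nat) (b : 'I_m -> R)
    (mm : 'I_m -> nat) (y : nat -> R) :
  (forall i, 0 < b i) -> (forall i, 2 <= mm i)%N -> 1 <= \sum_(j < m) b j ->
  y 0%N = 1 ->
  (forall n, (1 <= n)%N -> y n = \sum_(j < m) b j * y (n %/ mm j)%N) ->
  (forall n, 1 <= y n) /\ {homo y : k n / (k <= n)%N >-> k <= n}.
Proof.
move=> b0 mm2 B1 y0 yE.
have y1 n : 1 <= y n.
  elim/ltn_ind: n => -[|n] IHn; first by rewrite y0.
  rewrite yE//; apply: le_trans B1 _; apply: ler_sum => j _.
  by rewrite ler_peMr ?(ltW (b0 j))// IHn// ltn_Pdiv.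
split=> // k n; elim/ltn_ind: n k => -[|n] IHn [|k] kn //; first by rewrite y0.
rewrite !yE//; apply: ler_sum => j _; rewrite ler_wpM2l ?(ltW (b0 j))//.
by rewrite IHn ?ltn_Pdiv// leq_div2r.
Qed.

Lemma truncn_div {R : realType} (x : R) (d : nat) :
  (0 < d)%N -> Num.truncn (x / d%:R) = (Num.truncn x %/ d)%N.
Proof.
move=> d0; have d0R : 0 < d%:R :> R by rewrite ltr0n.
have [x0|x0] := ltP x 0.
  rewrite !(@truncn_floor R) !leNgt x0 /= ?div0n.
  by rewrite pmulr_llt0 ?invr_gt0// x0.
have /truncn_itv/andP[lo hi] := x0.
apply: truncn_def; rewrite ler_pdivlMr// ltr_pdivrMr// -!natrM.
apply/andP; split; first by apply: le_trans lo; rewrite ler_nat leq_divM.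
by apply: lt_le_trans hi _; rewrite ler_nat ltn_ceil.
Qed.

(** The renewal theorem in logarithmic scale.  The quotients [n %/ k] are
included because [y (n %/ k)] is [y] at the integer part of the real number
[n / k]: the rescaled sequence is then exactly [H (ln (n / k))] divided by
[k `^ s], which needs no control of rounding errors. *)
Lemma homogeneous_growth {R : realType} (m : nat) (b : 'I_m -> R)
    (mm : 'I_m -> nat) (s : R) (y : nat -> R) (j l : 'I_m) :
  (forall i, 0 < b i) -> (forall i, 2 <= mm i)%N ->
  irrational (ln (mm j)%:R / ln (mm l)%:R : R) ->
  1 <= \sum_(i < m) b i -> 0 < s ->
  \sum_(i < m) b i * (mm i)%:R `^ (- s) = 1 ->
  y 0%N = 1 ->
  (forall n, (1 <= n)%N -> y n = \sum_(i < m) b i * y (n %/ mm i)%N) ->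
  exists c C : R, [/\ 0 < c,
    (forall k n, (1 <= k <= n)%N ->
       y (n %/ k)%N / n%:R `^ s <= C / k%:R `^ s) &
    (forall k, (1 <= k)%N ->
       y (n %/ k)%N / n%:R `^ s @[n --> \oo] --> c / k%:R `^ s)].
Proof.
move=> b0 mm2 irr B1 s0 root y0 yE.
have [y1 ymono] := homogeneous_mono _ _ _ _ b0 mm2 B1 y0 yE.
pose H t := y (Num.truncn (expR t)) * expR (- (s * t)).
pose lam i : R := ln (mm i)%:R.
pose p i := b i * (mm i)%:R `^ (- s).
have mm0 i : 0 < (mm i)%:R :> R by rewrite ltr0n (ltn_trans _ (mm2 i)).
have elam i : expR (lam i) = (mm i)%:R by rewrite lnK// posrE.
have pE i : p i = b i * expR (- (s * lam i)).
  by rewrite /p /powR gt_eqF// mulNr.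
have p0 i : 0 < p i by rewrite pE mulr_gt0// expR_gt0.
pose W := \sum_i lam i; pose d : R := ln 2.
have d0 : 0 < d by rewrite ln_gt0// ltr1n.
have dlam1 i : d <= lam i by rewrite ler_ln ?posrE// ler_nat.
have dlam i : d <= lam i <= W.
  rewrite dlam1/= /W (bigD1 i)//= lerDl sumr_ge0// => k _.
  by apply: le_trans (dlam1 k); exact: ltW.
have HE (t : R) : 0 <= t -> H t = \sum_i p i * H (t - lam i).
  move=> t0; rewrite /H yE; last by rewrite truncn_gt0 -expR0 ler_expR.
  rewrite mulr_suml; apply: eq_bigr => i _.
  rewrite [expR (t - _)]expRD (expRN (lam i)) elam truncn_div -?(ltr0n R)//.
  have -> : - (s * (t - lam i)) = - (s * t) + s * lam i by ring.
  by rewrite expRD pE (expRN (s * lam i)); field; rewrite gt_eqF ?expR_gt0.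
(* Here [y] is at its initial value [1]: this window of negative times provides the
   bounds on [H]. *)
have small (t : R) : - W <= t < 0 -> H t = expR (- (s * t)).
  move=> /andP[_ t0]; rewrite /H (truncn0Pn _ _) ?y0 ?mul1r//.
  by rewrite -ltNge -expR0 ltr_expR.
pose C := expR (s * W).
have Hge (t : R) : - W <= t -> 1 <= H t.
  rewrite -[- W]add0r; apply: (@renewal_ge _ _ p lam d W H 0) => //.
  - by move=> i; exact: ltW.
  - move=> u; rewrite add0r => uW; rewrite small// -expR0 ler_expR.
    by move: uW => /andP[_ u0]; rewrite -mulrN mulr_ge0 ?oppr_ge0 ?(ltW u0) ?(ltW s0).
have Hle (t : R) : - W <= t -> H t <= C.
  rewrite -[- W]add0r; apply: (@renewal_le _ _ p lam d W H 0) => //.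
  - by move=> i; exact: ltW.
  - move=> u; rewrite add0r => uW; rewrite small// ler_expR -mulrN.
    by move: uW => /andP[Wu _]; rewrite ler_pM2l// lerNl.
have W0 : 0 <= W by have /andP[] := dlam j; lra.
have [c c1 Hc] : exists2 c : R, 1 <= c & H t @[t --> +oo] --> c.
  apply: (@renewal_cvg _ _ p lam d W s 1 C H j l) => //.
    by move=> t t0; rewrite Hge ?Hle//; lra.
  move=> t u tu; rewrite /H ![expR _ * (_ * _)]mulrCA -!expRD !subrr expR0 !mulr1.
  by apply: ymono; apply: le_truncn; rewrite ler_expR.
have yH k n : (1 <= k)%N -> (1 <= n)%N ->
    y (n %/ k)%N / n%:R `^ s = H (ln (n%:R / k%:R)) / k%:R `^ s.
  move=> k1 n1; have k0 : 0 < k%:R :> R by rewrite ltr0n.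
  have n0 : 0 < n%:R :> R by rewrite ltr0n.
  rewrite /H lnK ?posrE ?divr_gt0// truncn_div// (@natrK R).
  rewrite /powR !gt_eqF// -mulrA; congr (_ * _).
  by rewrite ln_div ?posrE// -!expRN -expRD; congr expR; ring.
exists c, C; split; first by lra.
  move=> k n /andP[k1 kn]; rewrite yH//; last exact: leq_trans kn.
  rewrite ler_wpM2r ?invr_ge0 ?powR_ge0// Hle//.
  apply: le_trans (_ : 0 <= _); first by lra.
  by rewrite ln_ge0// ler_pdivlMr ?ltr0n// mul1r ler_nat.
move=> k k1; have k0 : 0 < k%:R :> R by rewrite ltr0n.
have lim : H (ln (n%:R / k%:R)) / k%:R `^ s @[n --> \oo] --> c / k%:R `^ s.
  apply: cvgMl.
  have /cvg_pinftyP := Hc; apply.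
  apply/cvgryPge => A; near=> n.
  have n0 : k%:R * expR A <= n%:R.
    by near: n; exact: nbhs_infty_ger.
  rewrite -(expRK A) ler_ln ?posrE ?expR_gt0//; last first.
    rewrite divr_gt0//; apply: lt_le_trans n0.
    by rewrite mulr_gt0// expR_gt0.
  by rewrite ler_pdivlMr// mulrC.
apply: cvg_trans lim; apply: near_eq_cvg.
by near=> n; rewrite yH//; near: n; exact: nbhs_infty_ge.
Unshelve. all: by end_near.
Qed.

(** * Superposition of impulse responses *)

Definition impulse_response {R : realType} (B : R) (y : nat -> R) (k n : nat) : R :=
  if k == 0%N then y n else (y (n %/ k)%N - y (n %/ k.+1)%N) / (B - 1).

Lemma impulse_response_rec {R : realType} (m : nat) (b : 'I_m -> R)
    (mm : 'I_m -> nat) (y : nat -> R) (k n : nat) :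
  1 < \sum_(j < m) b j -> y 0%N = 1 ->
  (forall n, (1 <= n)%N -> y n = \sum_(j < m) b j * y (n %/ mm j)%N) ->
  (1 <= n)%N ->
  impulse_response (\sum_(j < m) b j) y k n = (k == n)%:R +
    \sum_(j < m) b j * impulse_response (\sum_(j < m) b j) y k (n %/ mm j)%N.
Proof.
set B := \sum_(j < m) b j => B1 y0 yE n1; rewrite /impulse_response.
case: eqVneq => [->|k0].
  by rewrite -[0 == n]/(0%N == n) eq_sym eqn0Ngt n1 add0r yE.
(* Each [y (_ %/ q)] solves the recurrence up to a constant defect on [n < q]; the
   defects for [q = k] and [q = k.+1] differ at [n = k] only. *)
have quot q : (0 < q)%N ->
    y (n %/ q)%N = \sum_(j < m) b j * y (n %/ mm j %/ q)%N + (n < q)%N%:R * (1 - B).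
  move=> q0; case: ltnP => nq.
    rewrite divn_small// y0 mul1r.
    under eq_bigr do rewrite divnAC (divn_small nq) div0n y0 mulr1.
    by rewrite addrC subrK.
  rewrite mul0r addr0 yE ?divn_gt0//.
  by apply: eq_bigr => j _; rewrite divnAC.
rewrite !quot// ?lt0n//.
have -> : (k == n)%:R = (n < k.+1)%N%:R - (n < k)%N%:R :> R.
  by rewrite ltnS [(n <= k)%N]leq_eqVlt eq_sym; case: ltngtP; rewrite ?subrr ?subr0.
under [in RHS]eq_bigr do rewrite mulrA mulrBr.
rewrite -mulr_suml sumrB.
by field; rewrite gt_eqF// subr_gt0.
Qed.

(** Terms with [k > n] vanish, so any [N > n] will do; an [N] that does not depend
on [n] is what the induction needs. *)
Lemma recurrence_superposition {R : realType} (m : nat) (b : 'I_m -> R)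
    (mm : 'I_m -> nat) (y a X : nat -> R) (N n : nat) :
  (forall i, 2 <= mm i)%N -> 1 < \sum_(j < m) b j -> y 0%N = 1 ->
  (forall n, (1 <= n)%N -> y n = \sum_(j < m) b j * y (n %/ mm j)%N) ->
  X 0%N = a 0%N ->
  (forall n, (1 <= n)%N -> X n = a n + \sum_(j < m) b j * X (n %/ mm j)%N) ->
  (n < N)%N ->
  X n = \sum_(0 <= k < N) a k * impulse_response (\sum_(j < m) b j) y k n.
Proof.
move=> mm2 B1 y0 yE X0 XE; elim/ltn_ind: n => n IHn nN.
have pick f : \sum_(0 <= k < N) f k * (k == n)%:R = f n :> R.
  rewrite big_mkord (bigD1 (Ordinal nN))//= eqxx mulr1 big1 ?addr0// => k kn.
  by rewrite -[k == n :> nat]/(k == Ordinal nN) (negbTE kn) mulr0.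
have [n0|n1] := posnP n.
  transitivity (a n); first by rewrite n0.
  rewrite -pick; apply: eq_bigr => k _; congr (_ * _).
  rewrite /impulse_response n0 !div0n subrr mul0r.
  by case: eqP => // _; rewrite y0.
rewrite XE// -[X in X + _]pick.
under [in RHS]eq_bigr do rewrite (impulse_response_rec _ _ mm)// mulrDr.
rewrite big_split/=; congr (_ + _).
under [in RHS]eq_bigr do rewrite mulr_sumr.
rewrite exchange_big/=; apply: eq_bigr => j _.
have jn : (n %/ mm j < n)%N by rewrite ltn_Pdiv.
rewrite IHn ?(ltn_trans jn nN)// mulr_sumr.
by apply: eq_bigr => k _; rewrite mulrCA.
Qed.

(** * Passage to the limit *)

(** Dominated convergence for series (Tannery's theorem), where the partial sums may
grow along with the parameter. *)
Lemma series_dominated_cvg {R : realType} (u : nat -> nat -> R)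
    (v M : nat -> R) :
  (forall n k, `|u n k| <= M k) -> cvgn (series M) ->
  (forall k, u n k @[n --> \oo] --> v k) ->
  cvgn (series v) /\
  \sum_(0 <= k < n.+1) u n k @[n --> \oo] --> limn (series v).
Proof.
move=> uM cM uv.
have M0 k : 0 <= M k by exact: le_trans (uM 0%N k).
have vM k : `|v k| <= M k.
  have := uv k; move=> /cvg_norm /cvgr_to_le; apply.
  by near=> n; rewrite uM.
have cv : cvgn (series v).
  by apply: normed_cvg; apply: series_le_cvg cM => // k; exact: normr_ge0.
split=> //; apply/cvgrPdist_le => e e0.
(* Beyond [K] the tails of [u n] and of [v] are both dominated by that of [M];
   before [K] there are finitely many terms. *)
have [K _ MK] : \forall K \near \oo, `|limn (series M) - series M K| <= e / 3.
  by move/cvgrPdist_le : cM; apply; rewrite divr_gt0.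
have Mhomo : {homo series M : k n / (k <= n)%N >-> k <= n}.
  by move=> k n kn; rewrite -subr_ge0 sub_series_geq// sumr_ge0.
have tail (w : nat -> R) n : (forall k, `|w k| <= M k) -> (K <= n)%N ->
    `|\sum_(K <= k < n) w k| <= e / 3.
  move=> wM Kn; apply: le_trans (ler_norm_sum _ _ _) _.
  apply: le_trans (_ : \sum_(K <= k < n) M k <= _); first exact: ler_sum.
  rewrite -sub_series_geq//; apply: le_trans (MK K (leqnn K)).
  apply: le_trans (ler_norm _); rewrite lerD2r.
  exact: nondecreasing_cvgn_le.
have vtail : `|limn (series v) - series v K| <= e / 3.
  have vK : `|series v n - series v K| @[n --> \oo] -->
      `|limn (series v) - series v K|.
    by apply: cvg_norm; apply: cvgB; [exact: cv | exact: cvg_cst].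
  apply: cvgr_to_le vK _; near=> n.
  have Kn : (K <= n)%N by near: n; exact: nbhs_infty_ge.
  by rewrite sub_series_geq// tail.
have head k : series (u n) k @[n --> \oo] --> series v k.
  elim: k => [|k IHk].
    by rewrite /series/= big_geq//; under eq_fun do rewrite big_geq//; exact: cvg_cst.
  rewrite seriesSr; under eq_fun do rewrite seriesSr.
  by apply: cvgD.
have e3 : 0 < e / 3 by rewrite divr_gt0.
near=> n.
have Kn : (K <= n.+1)%N by apply: leqW; near: n; exact: nbhs_infty_ge.
have -> : limn (series v) - \sum_(0 <= k < n.+1) u n k =
    (limn (series v) - series v K) + (series v K - series (u n) K)
    - \sum_(K <= k < n.+1) u n k.
  rewrite -(sub_series_geq (u n) Kn).
  by rewrite -[\sum_(0 <= k < n.+1) u n k]/(series (u n) n.+1) opprB !addrA !subrK.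
have hd : `|series v K - series (u n) K| <= e / 3.
  by near: n; move/cvgrPdist_le : (head K); apply.
have := tail (u n) n.+1 (uM n) Kn.
move: vtail hd; rewrite !ler_norml => /andP[? ?] /andP[? ?] /andP[? ?].
by apply/andP; split; lra.
Unshelve. all: by end_near.
Qed.

Theorem theorem1 (R : realType) (m : nat) (b : 'I_m -> R) (mm : 'I_m -> nat)
    (s0 : R)
    (hm : (1 <= m)%N)
    (hb : forall i : 'I_m, 0 < b i)
    (hmm : forall i : 'I_m, (2 <= mm i)%N)
    (hirr : exists j l : 'I_m, @irrational R (ln (mm j)%:R / ln (mm l)%:R))
    (hsum : 1 < \sum_(j < m) b j)
    (hs0 : 0 < s0)
    (hroot : \sum_(j < m) b j * (mm j)%:R `^ (- s0) = 1) :
  exists ell : nat -> R,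
    (forall j : nat, 0 < ell j) /\
    forall a : nat -> R,
      (\sum_(1 <= n <oo) (`|a n| / n%:R `^ s0)%:E < +oo)%E ->
      forall X : nat -> R,
        X 0%N = a 0%N ->
        (forall n : nat, (1 <= n)%N ->
           X n = a n + \sum_(j < m) b j * X (n %/ mm j)%N) ->
        cvgn (series (fun j : nat => ell j * a j)) /\
        X n / n%:R `^ s0 @[n --> \oo] -->
          limn (series (fun j : nat => ell j * a j)).
Proof.
have [j [l irr]] := hirr.
have [y [y0 yE]] := exists_homogeneous_solution _ b _ hmm.
have [y1 ymono] := homogeneous_mono _ _ _ _ hb hmm (ltW hsum) y0 yE.
have [c [C [c0 yC yc]]] :=
  homogeneous_growth _ _ _ _ _ _ _ hb hmm irr (ltW hsum) hs0 hroot y0 yE.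
set B := \sum_(j < m) b j in hsum.
have B0 : 0 < B - 1 by rewrite subr_gt0.
pose Z := impulse_response B y.
pose ell k := if k == 0%N then c
  else (c / k%:R `^ s0 - c / k.+1%:R `^ s0) / (B - 1).
have C0 : 0 <= C.
  have := yC 1%N 1%N isT; rewrite divnn/= powR1 !divr1; apply: le_trans.
  exact: le_trans (y1 _).
have Zlim k : Z k n / n%:R `^ s0 @[n --> \oo] --> ell k.
  rewrite /Z /impulse_response /ell; have [_|k0] := eqVneq k 0%N.
    by have := yc 1%N isT; under eq_fun do rewrite divn1; rewrite powR1 divr1.
  under eq_fun do rewrite mulrAC mulrBl.
  by apply: cvgMl; apply: cvgB; apply: yc; rewrite ?lt0n.
exists ell; split=> [k|a a_sum X X0 XE].
  rewrite /ell; have [//|k0] := eqVneq k 0%N.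
  rewrite divr_gt0// subr_gt0 ltr_pM2l// ltf_pV2 ?posrE ?powR_gt0 ?ltr0n ?lt0n//.
  by rewrite gt0_ltr_powR ?nnegrE// ltr_nat.
pose M k := if k == 0%N then `|a 0%N| * C
  else `|a k| / k%:R `^ s0 * (C / (B - 1)).
have Zbound k n : `|a k * (Z k n / n%:R `^ s0)| <= M k.
  rewrite normrM; have [->|n0] := posnP n.
    rewrite powR0 ?gt_eqF// invr0 mulr0 normr0 mulr0 /M.
    by case: ifP => _; rewrite !mulr_ge0 ?invr_ge0 ?powR_ge0 ?(ltW B0).
  have n1 : (1 <= n)%N by [].
  rewrite /Z /impulse_response /M; case: eqVneq => [->|k0].
    rewrite ler_wpM2l// ger0_norm; last first.
      by rewrite divr_ge0 ?powR_ge0//; apply: le_trans (y1 _).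
    by have := yC 1%N n n1; rewrite divn1 powR1 divr1.
  rewrite -[leRHS]mulrA ler_wpM2l// [leRHS]mulrA [_ * C]mulrC [X in `|X|]mulrAC normrM.
  rewrite [`|(B - 1)^-1|]ger0_norm ?invr_ge0 ?(ltW B0)// ler_pM2r ?invr_gt0//.
  have kpos : (0 < k)%N by rewrite lt0n.
  have [nk|kn] := ltnP n k.
    rewrite (divn_small nk) (divn_small (leqW nk)) subrr mul0r normr0.
    by rewrite divr_ge0 ?powR_ge0.
  apply: le_trans (yC k n _); last by rewrite kpos.
  rewrite ger0_norm; last first.
    by rewrite divr_ge0 ?powR_ge0// subr_ge0 ymono// leq_div2l.
  rewrite ler_wpM2r ?invr_ge0 ?powR_ge0// gerBl.
  exact: le_trans (y1 _).
(* As [0 `^ s0 = 0] and division by zero gives zero, the term of index [0] adds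
   nothing to the series of [w]. *)
have cvgM : cvgn (series M).
  pose w k := `|a k| / k%:R `^ s0.
  have w0 k : 0 <= w k by rewrite divr_ge0// powR_ge0.
  have cw : cvgn (series w).
    apply: nnseries_is_cvg => //; rewrite nneseries_recl//.
      by rewrite lte_add_pinfty// ltry.
    by move=> k _; rewrite lee_fin.
  have Mw : (fun n => \sum_(1 <= k < n) M k) =
      (fun n => \sum_(1 <= k < n) (C / (B - 1) *: w) k).
    apply/funext => n; apply: eq_big_nat => k /andP[k1 _].
    by rewrite /M (gtn_eqF k1) [LHS]mulrC.
  rewrite -(is_cvg_series_restrict 1) Mw is_cvg_series_restrict.
  exact: is_cvg_seriesZ.
have [cv lim] : cvgn (series (fun k => ell k * a k)) /\
    \sum_(0 <= k < n.+1) a k * (Z k n / n%:R `^ s0) @[n --> \oo] -->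
    limn (series (fun k => ell k * a k)).
  apply: (series_dominated_cvg _ _ M) => // k.
  by rewrite [ell k * _]mulrC; apply: cvgMr; exact: Zlim.
split=> //; apply: cvg_trans lim; apply: near_eq_cvg; near=> n.
rewrite (recurrence_superposition _ _ _ _ _ _ n.+1 n hmm hsum y0 yE X0 XE)//.
by rewrite mulr_suml; apply: eq_bigr => k _; rewrite mulrA.
Unshelve. all: by end_near.
Qed.
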